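(* Let $X=(x_i)_{i=1}^\infty$ be a coloration, $A(X)=(A_n(X))_{n=0}^\infty$ the sequence of the numbers of colored compositions of $n$ with coloration $X$, and $B(X)=(B_n(X))_{n=0}^\infty$ the sequence of the numbers of black tie compositions of $n$ with coloration $X$. Then $B(X)$ is the right shift of the convolution product of $A(X)$ with itself: $$B(X)=\sigma\bigl(A(X)*A(X)\bigr),$$ i.e. $B_0(X)=0$ and $B_{n+1}(X)=\sum_{k=0}^nA_{n-k}(X)A_k(X)$ for all $n\ge 0$.
   Context: A coloration is a sequence $X=(x_i)_{i=1}^\infty$ of non-negative integers; $x_i$ is the number of available colors of a part of size $i$ (if $x_i=0$, the part $i$ is not used). A colored composition of $n$ with coloration $X$ is a finite ordered sequence of parts, each part being a positive integer $i$ (its size) together with one of its $x_i$ colors, such that the sizes sum to $n$. $A_n(X)$ is the number of colored compositions of $n$ with coloration $X$, with $A_0(X)=1$. The color black is assumed not to belong to the coloration $X$. $M_n(X)$ is the set of black tie compositions of $n$ with coloration $X$: ordered sequences of parts with sizes summing to $n$, in which exactly one part is a black part of size $1$ (the black square) and every other part is a part of some size $i\ge1$ with one of the $x_i$ colors of $X$. $B_n(X)=|M_n(X)|$. For sequences $a=(a_n)_{n\ge0}$, $b=(b_n)_{n\ge 0}$, the convolution product $a*b$ has $n$-th term $\sum_{k=0}^na_{n-k}b_k$. The right-shift operator is $\sigma(a_0,a_1,a_2,\ldots)=(0,a_0,a_1,a_2,\ldots)$. *)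

(* Defs.v *)
From HB Require Import structures.
From mathcomp Require Import all_boot.

Set Implicit Arguments.
Unset Strict Implicit.
Unset Printing Implicit Defensive.

Definition part_size : Type := {i : nat | 0 < i}.

Definition coloration : Type := part_size -> nat.

(* The x_i colors of a part of size i are the elements of 'I_(X i), so no
   part of size i exists when x_i = 0. *)
Definition part (X : coloration) : Type := {i : part_size & 'I_(X i)}.

HB.instance Definition _ (X : coloration) := Countable.on (part X).

Definition size_of_part (X : coloration) (p : part X) : nat := val (tag p).

(* [None] is the black square, [Some p] a part p colored by X: black is thus
   not one of the colors of X. *)
Definition bt_part (X : coloration) : Type := option (part X).

HB.instance Definition _ (X : coloration) := Countable.on (bt_part X).

Definition size_of_bt_part (X : coloration) (p : bt_part X) : nat :=
  if p is Some q then size_of_part q else 1.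

Definition is_composition (X : coloration) (n : nat) (s : seq (part X)) : bool :=
  sumn [seq size_of_part p | p <- s] == n.

Definition is_black_tie (X : coloration) (n : nat) (s : seq (bt_part X)) : bool :=
  (sumn [seq size_of_bt_part p | p <- s] == n) && (count_mem None s == 1).

Record composition (X : coloration) (n : nat) : Type := Composition {
  composition_seq : seq (part X);
  _ : is_composition n composition_seq
}.

Record black_tie (X : coloration) (n : nat) : Type := BlackTie {
  black_tie_seq : seq (bt_part X);
  _ : is_black_tie n black_tie_seq
}.

HB.instance Definition _ X n := [isSub for @composition_seq X n].
HB.instance Definition _ X n := [Countable of composition X n by <:].

HB.instance Definition _ X n := [isSub for @black_tie_seq X n].
HB.instance Definition _ X n := [Countable of black_tie X n by <:].

(* The sequences over the alphabet [e] of length at most [n]. *)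
Fixpoint words (T : Type) (e : seq T) (n : nat) : seq (seq T) :=
  if n is m.+1 then [::] :: [seq x :: s | x <- e, s <- words e m] else [:: [::]].

Lemma mem_words (T : eqType) (e : seq T) n (s : seq T) :
  {subset s <= e} -> size s <= n -> s \in words e n.
Proof.
elim: n s => [|n IHn] [|x s] //= se ss; rewrite inE /=.
apply: allpairs_f; first by apply: se; rewrite mem_head.
by apply: IHn => // y sy; apply: se; rewrite inE sy orbT.
Qed.

Lemma sumn_words (T : eqType) (w : T -> nat) (e : seq T) n (s : seq T) :
    (forall x, 0 < w x) -> (forall x, w x <= n -> x \in e) ->
  sumn [seq w x | x <- s] = n -> s \in words e n.
Proof.
move=> w_gt0 we sn; apply: mem_words => [x xs|].
  by apply: we; rewrite -sn sumnE big_map (big_rem x) //= leq_addr.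
rewrite -sn; elim: s {sn} => //= x s IHs.
by rewrite -add1n leq_add.
Qed.

Definition parts_upto (X : coloration) (n : nat) : seq (part X) :=
  [seq Tagged (fun i => 'I_(X i)) c
    | i <- pmap insub (iota 0 n.+1), c <- enum 'I_(X i)].

Lemma mem_parts_upto (X : coloration) n (p : part X) :
  size_of_part p <= n -> p \in parts_upto X n.
Proof.
case: p => i c /= le_in; apply: allpairs_f_dep; last by rewrite mem_enum.
by rewrite mem_pmap_sub mem_iota.
Qed.

Definition bt_parts_upto (X : coloration) (n : nat) : seq (bt_part X) :=
  None :: map Some (parts_upto X n).

Lemma mem_bt_parts_upto (X : coloration) n (p : bt_part X) :
  size_of_bt_part p <= n -> p \in bt_parts_upto X n.
Proof.
case: p => [p|] //= le_pn; rewrite inE /=.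
by apply: map_f; apply: mem_parts_upto.
Qed.

Definition composition_enum (X : coloration) (n : nat) : seq (composition X n) :=
  undup (pmap insub (words (parts_upto X n) n)).

Lemma composition_enumP X n : Finite.axiom (composition_enum X n).
Proof.
apply: Finite.uniq_enumP; first exact: undup_uniq.
move=> c; rewrite mem_undup mem_pmap_sub.
have /eqP s_n := valP c.
apply: sumn_words s_n => [p|p]; first exact: (valP (tag p)).
exact: mem_parts_upto.
Qed.

HB.instance Definition _ X n :=
  isFinite.Build (composition X n) (@composition_enumP X n).

Definition black_tie_enum (X : coloration) (n : nat) : seq (black_tie X n) :=
  undup (pmap insub (words (bt_parts_upto X n) n)).

Lemma black_tie_enumP X n : Finite.axiom (black_tie_enum X n).
Proof.
apply: Finite.uniq_enumP; first exact: undup_uniq.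
move=> b; rewrite mem_undup mem_pmap_sub.
have /andP[/eqP s_n _] := valP b.
apply: sumn_words s_n => [[p|]|p] //; first exact: (valP (tag p)).
exact: mem_bt_parts_upto.
Qed.

HB.instance Definition _ X n :=
  isFinite.Build (black_tie X n) (@black_tie_enumP X n).

Definition nb_compositions (X : coloration) (n : nat) : nat := #|{: composition X n}|.

Definition nb_black_ties (X : coloration) (n : nat) : nat := #|{: black_tie X n}|.

(* The convention A_0(X) = 1 holds by counting the empty composition. *)
Lemma nb_compositions0 (X : coloration) : nb_compositions X 0 = 1.
Proof.
apply: (@eq_card1 _ (@Composition X 0 [::] (eqxx 0))).
case=> s s_0; rewrite !inE; apply/esym/eqP/val_inj => /=.
case: s s_0 => //= p s /eqP /=.
by case: p => [[[|i] // i_gt0] c].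
Qed.

Definition convolution (a b : nat -> nat) : nat -> nat :=
  fun n => \sum_(k < n.+1) a (n - k) * b k.

Definition right_shift (a : nat -> nat) : nat -> nat :=
  fun n => if n is m.+1 then a m else 0.

(* Main.v *)
Require Import Defs.
From mathcomp Require Import all_boot.

(** A black tie composition is the same thing as an ordered pair of colored
compositions: the one before the black square and the one after it. The square
has size 1, so the two compositions have total size n when the black tie has
size n.+1. Sorting the pairs by the size k of the second composition gives
the n-th term of the convolution, and the square accounts for the shift.

The bijection is first studied on bare sequences, as the map [tie]: it is
injective ([tie_inj]), its image consists of the sequences with a single black
square ([black_squareP]), and it adds 1 to the total size
([sumn_size_tie]). Sizes are then put back by the map [tie_of], from the
disjoint union over k of the products of types of compositions. *)

Set Implicit Arguments.
Unset Strict Implicit.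
Unset Printing Implicit Defensive.

Definition tie (X : coloration) (a b : seq (part X)) : seq (bt_part X) :=
  map Some a ++ None :: map Some b.

(** The black square cannot come from either side, so it marks where the first
sequence stops. *)
Lemma tie_inj (X : coloration) (a b a' b' : seq (part X)) :
  tie a b = tie a' b' -> a = a' /\ b = b'.
Proof.
rewrite /tie; elim: a a' => [|x a IHa] [|x' a'] //=.
  by case=> /(inj_map (@Some_inj _)) ->.
by case=> -> /IHa[-> ->].
Qed.

Lemma count_None_map_Some (T : eqType) (s : seq T) :
  count_mem None (map Some s) = 0.
Proof. by elim: s. Qed.

Lemma count_None_eq0 (T : eqType) (s : seq (option T)) :
  count_mem None s = 0 -> exists a, s = map Some a.
Proof.
elim: s => [|[x|] s IHs] //=; first by exists [::].
by move=> /IHs[a ->]; exists (x :: a).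
Qed.

(** Cut at the black square: nothing is lost on either side, because a sequence
without [None] is in the image of [map Some]. *)
Lemma black_squareP (X : coloration) (s : seq (bt_part X)) :
  reflect (exists a b, s = tie a b) (count_mem None s == 1).
Proof.
apply: (iffP eqP) => [|[a [b ->]]]; last first.
  by rewrite /tie count_cat /= !count_None_map_Some.
elim: s => [|[x|] s IHs] //=.
  by move=> /IHs[a [b ->]]; exists (x :: a), b.
by case=> /count_None_eq0[b ->]; exists [::], b.
Qed.

Lemma sumn_size_tie (X : coloration) (a b : seq (part X)) :
  sumn [seq size_of_bt_part p | p <- tie a b] =
    (sumn [seq size_of_part p | p <- a]
      + sumn [seq size_of_part p | p <- b]).+1.
Proof. by rewrite map_cat sumn_cat /= -!map_comp add1n addnS. Qed.

Lemma tie_black_tie (X : coloration) n (k : 'I_n.+1)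
    (a : composition X (n - k)) (b : composition X k) :
  is_black_tie n.+1 (tie (val a) (val b)).
Proof.
apply/andP; split; last by apply/black_squareP; exists (val a), (val b).
rewrite sumn_size_tie (eqP (valP a)) (eqP (valP b)).
by rewrite subnK // -ltnS ltn_ord.
Qed.

Definition tie_of (X : coloration) n
    (u : {k : 'I_n.+1 & (composition X (n - k) * composition X k)%type}) :
  black_tie X n.+1 := BlackTie (tie_black_tie (tagged u).1 (tagged u).2).

Lemma tie_of_inj (X : coloration) n : injective (@tie_of X n).
Proof.
move=> [k [[a sa] [b sb]]] [k' [[a' sa'] [b' sb']]].
case=> /tie_inj[eq_a eq_b]; move: sa' sb'; rewrite -{}eq_a -{}eq_b => sa' sb'.
(* The tag can be read off the second sequence: it is its total size. *)
have eq_k : k = k' by apply: val_inj; rewrite /= -(eqP sb) (eqP sb').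
case: k' / eq_k sa' sb' => sa' sb'.
by rewrite (bool_irrelevance sa sa') (bool_irrelevance sb sb').
Qed.

Lemma tie_of_surj (X : coloration) n (t : black_tie X n.+1) :
  exists u, t = tie_of u.
Proof.
have /andP[/eqP size_t /black_squareP[a [b def_t]]] := valP t.
move: size_t; rewrite def_t sumn_size_tie => -[size_ab].
set k := sumn [seq size_of_part p | p <- b] in size_ab.
have k_lt : k < n.+1 by rewrite ltnS -size_ab leq_addl.
have sa : is_composition (n - Ordinal k_lt) a.
  by rewrite /is_composition /= -size_ab addnK.
have sb : is_composition (Ordinal k_lt) b by exact: eqxx.
exists (Tagged (fun k : 'I_n.+1 => (composition X (n - k) * composition X k)%type)
  (Composition sa, Composition sb)).
exact: val_inj.
Qed.

Theorem theorem8 (X : coloration) :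
  forall n : nat,
    nb_black_ties X n =
    right_shift (convolution (nb_compositions X) (nb_compositions X)) n.
Proof.
case=> [|n] /=.
  (* The black square alone already has size 1. *)
  apply: eq_card0 => t.
  have /andP[/eqP size_t /black_squareP[a [b def_t]]] := valP t.
  by move: size_t; rewrite def_t sumn_size_tie.
transitivity
  #|{: {k : 'I_n.+1 & (composition X (n - k) * composition X k)%type}}|.
  rewrite -(card_codom (@tie_of_inj X n)); apply/esym/eq_card => t.
  by rewrite [RHS]inE; apply/codomP/tie_of_surj.
rewrite card_tagged sumnE big_map big_enum /=.
by apply: eq_bigr => k _; rewrite card_prod.
Qed.
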